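(* Let $E$ be a $G$-equivariant $V$-embedded vector bundle on $X=X_1\cup\ldots\cup X_k$. Let $\alpha,\beta\in\mathbb{N}_0^k$, $i,j\in\{1,\ldots,k\}$, $s\in\mathbb{N}_0$, and for $t\in\mathbb{N}_0$ put $b_t:=b_{\alpha,\beta+te_j,i}$, where $e_j$ is the $j$-th standard basis vector. Let $z=(z_1,\ldots,z_s)$ be general points of $X_j$, let $x=(x_1,\ldots,x_r)$ be a sequence of general points of type $\beta$, where $r=|\beta|$, and let $y$ be a general point of $X_i$. If $0\ne b_s=b_{s+1}$, then $$\mathrm{ap}_{\alpha}^{(x,z)}(E)\cap E_y=\mathrm{ap}_{\alpha+se_j}^{x}(E)\cap E_y.$$
   Context: All varieties are over $\mathbb{C}$. $G$ is a group, $V$ is a finite-dimensional $G$-module, and $X$ is a (quasi-)affine cone which lies in some $G$-module and is closed under the $G$-action, with irreducible components $X_1,\ldots,X_k$. A $V$-embedded vector bundle $E$ on $X$ is an algebraic vector bundle $\pi\colon E\to X$ (Zariski-locally trivial) all of whose fibers $E_x=\pi^{-1}(\{x\})$, $x\in X$, are linear subspaces of $V$; it is $G$-equivariant if $E_{gx}=gE_x$ for all $g\in G$, $x\in X$. For $\alpha\in\mathbb{N}_0^k$ write $|\alpha|=\alpha_1+\ldots+\alpha_k$. A sequence of $|\alpha|$ points of $X$ is of (component) type $\alpha$ if exactly $\alpha_i$ of them lie in $X_i$ for each $i$ and none lies in the intersection of two components. It is a general sequence of type $\alpha$ if, in addition, each point is a general point of one of the components. Partial apex: for a sequence $x=(x_1,\ldots,x_r)$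 in $X$ and $\alpha\in\mathbb{N}_0^k$ with $m=|\alpha|$, define $$\mathrm{ap}_{\alpha}^{x}(E):=\bigcap_{(y_1,\ldots,y_m)}\langle E_{x_1},\ldots,E_{x_r},E_{y_1},\ldots,E_{y_m}\rangle,$$ where the intersection runs over all sequences $(y_1,\ldots,y_m)$ in $X$ of type $\alpha$ for which the space $\langle E_{x_1},\ldots,E_{x_r},E_{y_1},\ldots,E_{y_m}\rangle$ has the generic dimension (the dimension attained for a general sequence of type $\alpha$, with $x$ fixed). For $\alpha,\beta\in\mathbb{N}_0^k$ and $i\in\{1,\ldots,k\}$ define $b_{\alpha,\beta,i}:=\dim\bigl(\mathrm{ap}_{\alpha}^{x}(E)\cap E_y\bigr)$, where $x$ is a general sequence in $X$ of type $\beta$ and $y\in X_i$ is a general point; this number depends only on $\alpha,\beta,i$. *)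

(* Defs.v *)
From HB Require Import structures.
From mathcomp Require Import all_boot all_order all_algebra.
From mathcomp Require Import boolp classical_sets reals.
From mathcomp Require Import complex.
From mathcomp Require mpoly.

Set Implicit Arguments.
Unset Strict Implicit.
Unset Printing Implicit Defensive.

Import GRing.Theory.

Local Open Scope ring_scope.
Local Open Scope classical_set_scope.

Section Zariski.
Variables (F : fieldType) (U : vectType F).
Implicit Types (A Y Z O : set U).

(* The coordinates are taken in the basis [vbasis fullv]; polynomiality does
   not depend on this choice. *)
Definition peval (p : mpoly.mpoly (\dim {:U}) F) (u : U) : F :=
  mpoly.meval (fun i => coord (vbasis {:U}) i u) p.

Definition zariski_closed Z : Prop :=
  exists S : set (mpoly.mpoly (\dim {:U}) F),
    Z = [set u | forall p, S p -> peval p u = 0].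

Definition zariski_open O : Prop := zariski_closed (~` O).

Definition locally_closed A : Prop :=
  exists Z O, [/\ zariski_closed Z, zariski_open O & A = Z `&` O].

Definition irreducible A : Prop :=
  A !=set0 /\
  forall Z1 Z2, zariski_closed Z1 -> zariski_closed Z2 ->
    A `<=` Z1 `|` Z2 -> A `<=` Z1 \/ A `<=` Z2.

Definition irreducible_component A Y : Prop :=
  [/\ Y `<=` A, irreducible Y &
      forall Y', irreducible Y' -> Y' `<=` A -> Y `<=` Y' -> Y' = Y].

Definition irreducible_components A (k : nat) (Y : 'I_k -> set U) : Prop :=
  [/\ injective Y, forall i, irreducible_component A (Y i) &
      A = \bigcup_(i in setT) Y i].

(* [P] holds at a general point of [A], i.e., on a relatively open dense
   subset of [A].  A general tuple is a general point of the set of all tuples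
   of the given kind, inside the product of the ambient spaces. *)
Definition generically A (P : U -> Prop) : Prop :=
  exists O, [/\ zariski_open O,
    (forall O', zariski_open O' -> A `&` O' !=set0 ->
       A `&` O `&` O' !=set0) &
    forall u, A u -> O u -> P u].

(* The value taken by [f] at a general point of [A]; it is unique if [A] is
   nonempty, and 0 by convention if there is no such value. *)
Definition generic_value A (f : U -> nat) : nat :=
  xget 0%N [set d | generically A (fun u => f u = d)].

End Zariski.

Section Regular.
Variables (F : fieldType) (U U' : vectType F).

Definition regular_on (A : set U) (f : U -> U') : Prop :=
  forall a, A a ->
    exists (q : mpoly.mpoly (\dim {:U}) F)
           (p : 'I_(\dim {:U'}) -> mpoly.mpoly (\dim {:U}) F),
      peval q a != 0 /\
      forall b, A b -> peval q b != 0 ->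
        forall l, coord (vbasis {:U'}) l (f b) = peval (p l) b / peval q b.

End Regular.

Section Module.
Variables (F : fieldType) (G : groupType) (U : vectType F).

Definition is_gmodule (rho : G -> 'End(U)) : Prop :=
  rho 1%g = \1%VF /\ forall g h, rho (g * h)%g = (rho g \o rho h)%VF.

End Module.

Section Cone.
Variables (F : fieldType) (W : vectType F).

(* An affine cone is also closed under scaling by 0; a quasi-affine cone, e.g.
   an affine cone without its vertex, need not be. *)
Definition quasi_affine_cone (X : set W) : Prop :=
  locally_closed X /\ forall (a : F) w, a != 0 -> X w -> X (a *: w).

End Cone.

Section EmbeddedBundle.
Variables (F : fieldType) (W V : vectType F).
Variable E : W -> {vspace V}.

(* The total space over [A] is the set of all (x, v) with x in A, v in E x.
   [phi] is the second component of a morphism over [A] from A x F^n to it, and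
   [psi] that of the inverse morphism. *)
Definition trivial_bundle_on (A : set W) : Prop :=
  exists (n : nat) (phi : W * 'rV[F]_n -> V) (psi : W * V -> 'rV[F]_n),
    [/\ regular_on [set p | A p.1] phi,
        regular_on [set p | A p.1 /\ p.2 \in E p.1] psi,
        (forall x, A x -> linear (fun c => phi (x, c))),
        (forall x c, A x -> phi (x, c) \in E x /\ psi (x, phi (x, c)) = c) &
        forall x v, A x -> v \in E x -> phi (x, psi (x, v)) = v].

Definition embedded_vector_bundle (X : set W) : Prop :=
  forall x, X x -> exists O,
    [/\ zariski_open O, O x & trivial_bundle_on (X `&` O)].

Definition equivariant (G : groupType) (rhoW : G -> 'End(W))
    (rhoV : G -> 'End(V)) (X : set W) : Prop :=
  forall g x, X x -> E (rhoW g x) = (rhoV g @: E x)%VS.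

End EmbeddedBundle.

Section BigCap.
Variables (F : fieldType) (V : vectType F).

(* Intersection of a possibly infinite family of subspaces. *)
Definition vbigcap (S : set {vspace V}) : {vspace V} :=
  xget fullv [set L : {vspace V} | forall v, v \in L <-> forall M, S M -> v \in M].

Lemma memv_bigcap (S : set {vspace V}) (v : V) :
  v \in vbigcap S <-> forall M, S M -> v \in M.
Proof.
rewrite /vbigcap; case: xgetP => [L _ -> //|noL]; exfalso.
pose low (L : {vspace V}) := forall M, S M -> (L <= M)%VS.
pose P d := `[< exists2 L, low L & \dim L = d >].
have exP : exists d, P d.
  exists 0%N; apply/asboolP; exists 0%VS; last by rewrite dimv0.
  by move=> M _; apply: sub0v.
have ubP d : P d -> (d <= \dim {:V})%N.
  by move=> /asboolP[L _ <-]; apply/dimvS/subvf.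
case: (ex_maxnP exP ubP) => d /asboolP[L lowL dimL] maxd.
apply: (noL L) => w; split=> [wL M SM|allw]; first exact: (subvP (lowL M SM)).
have lowLw : low (L + <[w]>)%VS.
  by move=> M SM; rewrite subv_add lowL //= -memvE allw.
have /maxd : P (\dim (L + <[w]>)) by apply/asboolP; exists (L + <[w]>)%VS.
rewrite -dimL => le_dim; have /eqP -> : L == (L + <[w]>)%VS.
  by rewrite eqEdim addvSl.
exact: (subvP (addvSr L _)) (memv_line w).
Qed.

End BigCap.

Section PartialApex.
Variables (F : fieldType) (W V : vectType F).
Variables (k : nat) (Xc : 'I_k -> set W).
Variable E : W -> {vspace V}.
Implicit Types (alpha beta : 'I_k -> nat) (xs : seq W).

Definition size_type alpha : nat := (\sum_i alpha i)%N.

(* [add_unit alpha t j] is alpha + t e_j. *)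
Definition add_unit alpha (t : nat) (j : 'I_k) : 'I_k -> nat :=
  fun l => (alpha l + (if l == j then t else 0))%N.

Definition of_type alpha (y : {ffun 'I_(size_type alpha) -> W}) : Prop :=
  [/\ forall l, exists i, Xc i (y l),
      forall i, #|[set l | `[< Xc i (y l) >]]%SET| = alpha i &
      forall l i i', Xc i (y l) -> Xc i' (y l) -> i = i'].

Definition span_fibers xs : {vspace V} := (\sum_(w <- xs) E w)%VS.

Definition generic_dim alpha xs : nat :=
  generic_value (@of_type alpha)
    (fun y => \dim (span_fibers (xs ++ codom y))).

Definition apex alpha xs : {vspace V} :=
  vbigcap [set L : {vspace V} | exists2 y : {ffun 'I_(size_type alpha) -> W}, of_type y &
    \dim (span_fibers (xs ++ codom y)) = generic_dim alpha xs /\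
    L = span_fibers (xs ++ codom y)].

(* The pair p consists of a sequence of type beta and a point of [Xc i]. *)
Definition bnum alpha beta (i : 'I_k) : nat :=
  generic_value
    [set p : {ffun 'I_(size_type beta) -> W} * W | of_type p.1 /\ Xc i p.2]
    (fun p => \dim (apex alpha (codom p.1) :&: E p.2)).

End PartialApex.

(* Main.v *)
Require Import Defs.
From HB Require Import structures.
From mathcomp Require Import all_boot all_order all_algebra.
From mathcomp Require Import boolp classical_sets reals.
From mathcomp Require Import complex.
From mathcomp Require Import mpoly.

Set Implicit Arguments.
Unset Strict Implicit.
Unset Printing Implicit Defensive.

Import GRing.Theory.

Local Open Scope ring_scope.
Local Open Scope classical_set_scope.

(* Dimensions of spans of fibres are lower semicontinuous, and sequences with
   prescribed components form irreducible sets; hence a partial apex only grows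
   when points are added to the base sequence.  For general points
   z_1, ..., z_s, z'_1, ..., z'_s of X_j, put
   w_t = (z_(t+1), ..., z_s, z'_1, ..., z'_t).  If b_s = b_(s+1), then the
   intersections of E_y with the partial apices at (x, w_t) and (x, w_(t+1))
   both equal the one at the join of w_t and w_(t+1).  So z may be exchanged
   for z' point by point, and the intersection over all z' of the partial
   apices at (x, z') is the partial apex of type alpha + s e_j at x.
   The assumption b_s <> 0 excludes the junk value 0 of [generic_value]. *)

(** The exchange works only for general z', whereas the apex of type alpha + s e_j runs over every
    sequence of maximal span, special ones included. A vector v outside such a span at a special
    z'_0 stays outside for all nearby z': dim(span + <v>) cannot drop locally, and the span already
    has maximal dimension. So z'_0 may be replaced by a general z'. Semicontinuity is used in this
    way for spans only; the dimensions of apices, which are infinite intersections, are controlled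
    solely by the dense open sets that [generic_value] supplies. The sequences of a given type form
    a reducible set, since a type does not say which entry lies on which component. It splits into
    irreducible pieces indexed by the list of components. As spans ignore the order, a sequence of
    maximal span can be rearranged into any piece, and density is checked piece by piece. *)

Section PolynomialFunctions.
Variables (F : fieldType) (U U' : vectType F).

(** * Polynomial functions and maps *)

Definition polyfun (f : U -> F) : Prop := exists p, f =1 peval p.

Definition polymap (f : U -> U') : Prop :=
  forall l, polyfun (fun u => coord (vbasis {:U'}) l (f u)).

Lemma polyfun_ext f g : f =1 g -> polyfun f -> polyfun g.
Proof. by move=> fg [p hp]; exists p => u; rewrite -fg. Qed.

Lemma polyfun_peval p : polyfun (peval p).
Proof. by exists p. Qed.

Lemma polyfun_cst c : polyfun (fun=> c).
Proof. by exists c%:MP => u; rewrite /peval mevalC. Qed.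

Lemma polyfun_coord i : polyfun (coord (vbasis {:U}) i).
Proof. by exists 'X_i => u; rewrite /peval mevalXU. Qed.

Lemma polyfunD f g : polyfun f -> polyfun g -> polyfun (fun u => f u + g u).
Proof.
by move=> [p hp] [q hq]; exists (p + q) => u; rewrite /peval mevalD hp hq.
Qed.

Lemma polyfunM f g : polyfun f -> polyfun g -> polyfun (fun u => f u * g u).
Proof.
by move=> [p hp] [q hq]; exists (p * q) => u; rewrite /peval mevalM hp hq.
Qed.

Lemma polyfun_sum (I : Type) (r : seq I) (P : pred I) (f : I -> U -> F) :
  (forall i, polyfun (f i)) -> polyfun (fun u => \sum_(i <- r | P i) f i u).
Proof.
move=> hf; elim: r => [|i r IH].
  by apply: polyfun_ext (polyfun_cst 0) => u; rewrite big_nil.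
case Pi: (P i).
  by apply: polyfun_ext (polyfunD (hf i) IH) => u; rewrite big_cons Pi.
by apply: polyfun_ext IH => u; rewrite big_cons Pi.
Qed.

Lemma polyfun_prod (I : Type) (r : seq I) (P : pred I) (f : I -> U -> F) :
  (forall i, polyfun (f i)) -> polyfun (fun u => \prod_(i <- r | P i) f i u).
Proof.
move=> hf; elim: r => [|i r IH].
  by apply: polyfun_ext (polyfun_cst 1) => u; rewrite big_nil.
case Pi: (P i).
  by apply: polyfun_ext (polyfunM (hf i) IH) => u; rewrite big_cons Pi.
by apply: polyfun_ext IH => u; rewrite big_cons Pi.
Qed.

Lemma polyfunX f n : polyfun f -> polyfun (fun u => f u ^+ n).
Proof.
move=> hf; apply: polyfun_ext (polyfun_prod (index_enum 'I_n) predT (fun=> hf)).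
by move=> u; rewrite prodr_const card_ord.
Qed.

Lemma polyfun_det n (f : U -> 'M[F]_n) :
  (forall i j, polyfun (fun u => f u i j)) -> polyfun (fun u => \det (f u)).
Proof.
move=> hf; apply: polyfun_sum => s; apply: polyfunM; first exact: polyfun_cst.
by apply: polyfun_prod.
Qed.

(** Product and function spaces carry an abstract [vbasis], unrelated to the bases of their factors.
    Linearity yields polynomiality of projections and pairings without inspecting any basis. *)
Lemma polyfun_linear (f : U -> F) :
  (forall a u v, f (a *: u + v) = a * f u + f v) -> polyfun f.
Proof.
move=> lf.
have lf' : linear_for *%R f by [].
pose g : {linear U -> F | *%R} :=
  HB.pack f (GRing.isLinear.Build F U F *%R f lf').
have h : polyfun (fun u => \sum_(i < \dim {:U})
    coord (vbasis {:U}) i u * f (vbasis {:U})`_i).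
  apply: polyfun_sum => i; apply: polyfunM; last exact: polyfun_cst.
  exact: polyfun_coord.
apply: polyfun_ext h => u.
rewrite [in RHS](coord_vbasis (memvf u)) -[f]/(g : U -> F) linear_sum.
by apply: eq_bigr => i _; rewrite linearZ.
Qed.

Lemma polymap_ext (f g : U -> U') : f =1 g -> polymap f -> polymap g.
Proof. by move=> fg hf l; apply: polyfun_ext (hf l) => u; rewrite fg. Qed.

Lemma polymap_cst c : polymap (fun=> c).
Proof. by move=> l; apply: polyfun_cst. Qed.

Lemma polymapD (f g : U -> U') :
  polymap f -> polymap g -> polymap (fun u => f u + g u).
Proof.
move=> hf hg l; apply: polyfun_ext (polyfunD (hf l) (hg l)) => u.
by rewrite linearD.
Qed.

Lemma polymap_scale (f : U -> F) (c : U') :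
  polyfun f -> polymap (fun u => f u *: c).
Proof.
move=> hf l; have := polyfunM hf (polyfun_cst (coord (vbasis {:U'}) l c)).
by apply: polyfun_ext => u; rewrite linearZ.
Qed.

Lemma polymap_sum (I : Type) (r : seq I) (f : I -> U -> U') :
  (forall i, polymap (f i)) -> polymap (fun u => \sum_(i <- r) f i u).
Proof.
move=> hf l; apply: polyfun_ext (polyfun_sum r predT (fun i => hf i l)) => u.
by rewrite linear_sum.
Qed.

Lemma polymap_linear (f : U -> U') : linear f -> polymap f.
Proof. by move=> lf l; apply: polyfun_linear => a u v; rewrite lf linearP. Qed.

End PolynomialFunctions.

Section PolynomialComposition.
Variables (F : fieldType) (U U' : vectType F).

Lemma polyfun_comp (h : U' -> F) (f : U -> U') :
  polyfun h -> polymap f -> polyfun (h \o f).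
Proof.
move=> [p hp] hf.
suff H : polyfun (fun u => \sum_(m <- msupp p)
    p@_m * \prod_i coord (vbasis {:U'}) i (f u) ^+ m i).
  by apply: polyfun_ext H => u /=; rewrite hp /peval mevalE.
apply: polyfun_sum => m; apply: polyfunM; first exact: polyfun_cst.
by apply: polyfun_prod => i; apply: polyfunX; apply: hf.
Qed.

Lemma polymap_comp (U'' : vectType F) (g : U' -> U'') (f : U -> U') :
  polymap g -> polymap f -> polymap (g \o f).
Proof. by move=> hg hf l; apply: (polyfun_comp (hg l) hf). Qed.

End PolynomialComposition.

(** * Zariski topology, general points and irreducibility *)

Section ZariskiTopology.
Variables (F : fieldType) (U : vectType F).
Implicit Types (A Z O : set U).

Lemma closed_bigcap (I : Type) (D : set I) (Z : I -> set U) :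
  (forall i, D i -> zariski_closed (Z i)) ->
  zariski_closed (\bigcap_(i in D) Z i).
Proof.
move=> cZ; exists [set p | exists2 i, D i & forall u, Z i u -> peval p u = 0].
apply/seteqP; split=> [u Zu p [i Di]|u /= hu i Di]; first by apply; apply: Zu.
have [S hS] := cZ i Di; rewrite hS => p Sp.
by apply: hu; exists i => // v; rewrite hS; apply.
Qed.

Lemma closedU Z1 Z2 :
  zariski_closed Z1 -> zariski_closed Z2 -> zariski_closed (Z1 `|` Z2).
Proof.
move=> [S1 ->] [S2 ->].
exists [set r | exists p q, [/\ S1 p, S2 q & r = p * q]].
apply/seteqP; split=> [u hu r [p [q [Sp Sq ->]]]|u /= hu].
  rewrite /peval mevalM.
  by case: hu => hu; [rewrite [X in X * _](hu p Sp) mul0r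
                     |rewrite [X in _ * X](hu q Sq) mulr0].
apply: contrapT => /not_orP[/existsNP[p /not_implyP[Sp /eqP np]]].
move=> /existsNP[q /not_implyP[Sq /eqP nq]].
have := hu (p * q) (ex_intro _ p (ex_intro _ q (And3 Sp Sq erefl))).
by move/eqP; rewrite /peval mevalM mulf_eq0 (negPf np) (negPf nq).
Qed.

Lemma closed0 : zariski_closed (set0 : set U).
Proof.
exists setT; apply/seteqP; split=> // u /= /(_ 1 I).
by rewrite /peval meval1 => /eqP; rewrite oner_eq0.
Qed.

Lemma openT : zariski_open (setT : set U).
Proof. by rewrite /zariski_open setCT; apply: closed0. Qed.

Lemma openI O1 O2 : zariski_open O1 -> zariski_open O2 ->
  zariski_open (O1 `&` O2).
Proof. by move=> o1 o2; rewrite /zariski_open setCI; apply: closedU. Qed.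

Lemma open_bigcup (I : Type) (D : set I) (O : I -> set U) :
  (forall i, D i -> zariski_open (O i)) ->
  zariski_open (\bigcup_(i in D) O i).
Proof. by move=> hO; rewrite /zariski_open setC_bigcup; apply: closed_bigcap. Qed.

Lemma open_bigcap_seq (I : eqType) (r : seq I) (O : I -> set U) :
  (forall i, zariski_open (O i)) ->
  zariski_open [set u | forall i, i \in r -> O i u].
Proof.
move=> hO; elim: r => [|i r IH].
  by rewrite (_ : [set _ | _] = setT); [exact: openT|apply/seteqP; split].
rewrite (_ : [set _ | _] = O i `&` [set u | forall i, i \in r -> O i u]).
  exact: openI.
apply/seteqP; split=> u /= => [hu|[Oi hu] l].
  by split=> [|l lr]; apply: hu; rewrite inE ?eqxx ?lr ?orbT.
by rewrite inE => /orP[/eqP->|/hu].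
Qed.

Lemma open_neq0 (f : U -> F) : polyfun f -> zariski_open [set u | f u != 0].
Proof.
move=> [p hp]; exists [set p]; apply/seteqP; split=> u /=.
  by move=> /negP; rewrite negbK => /eqP fu q ->; rewrite -hp.
by move=> /(_ p erefl) pu; apply/negP; rewrite negbK hp pu.
Qed.

(** The union of all open sets on which P holds is the best candidate, so density can be tested
    against one O' at a time. The open set may thus depend on the irreducible piece that O'
    meets. *)
Lemma generically_local A (P : U -> Prop) :
  (forall O', zariski_open O' -> A `&` O' !=set0 ->
    exists O, [/\ zariski_open O, A `&` O `&` O' !=set0 &
      forall u, A u -> O u -> P u]) ->
  generically A P.
Proof.
move=> H; pose C := [set O | zariski_open O /\ forall u, A u -> O u -> P u].
exists (\bigcup_(O in C) O); split.
- by apply: open_bigcup => O [].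
- move=> O' oO' /(H _ oO')[O [oO [u [[Au Ou] O'u]] hP]].
  by exists u; split=> //; split=> //; exists O.
- by move=> u Au [O [_ hP] Ou]; apply: hP.
Qed.

Lemma generic_valueP A (f : U -> nat) :
  generic_value A f <> 0%N -> generically A (fun u => f u = generic_value A f).
Proof. by rewrite /generic_value; case: xgetP. Qed.

(** Two relatively dense open subsets of a nonempty A meet inside A, so there is at most one general
    value. *)
Lemma generic_value_eq A (f : U -> nat) d : A !=set0 ->
  generically A (fun u => f u = d) -> generic_value A f = d.
Proof.
move=> [a Aa] gd; rewrite /generic_value; case: xgetP => [e _ ge|/(_ d)//].
have [O [oO dO hO]] := gd; have [O' [oO' dO' hO']] := ge.
have [|u [[Au O'u] Ou]] := dO' O oO.
  have [|u [[Au Ou] _]] := dO setT openT; first by exists a.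
  by exists u.
by rewrite -(hO u) // -(hO' u).
Qed.

Lemma irreducibleW A O1 O2 : irreducible A ->
  zariski_open O1 -> zariski_open O2 ->
  A `&` O1 !=set0 -> A `&` O2 !=set0 -> A `&` (O1 `&` O2) !=set0.
Proof.
move=> [_ irrA] o1 o2 [a1 [A1 O1a]] [a2 [A2 O2a]]; apply: contrapT => h.
have [|/(_ _ A1)//|/(_ _ A2)//] := irrA _ _ o1 o2.
move=> a Aa; apply: contrapT => /not_orP[/contrapT n1 /contrapT n2].
by apply: h; exists a.
Qed.

(** On an irreducible set this is equivalent to [generically], because nonempty open subsets are
    dense there. *)
Definition on_some_open A (P : U -> Prop) : Prop :=
  exists O, [/\ zariski_open O, A `&` O !=set0 & forall u, A u -> O u -> P u].

Lemma irreducible_some_open_and A (P Q : U -> Prop) : irreducible A ->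
  on_some_open A P -> on_some_open A Q -> on_some_open A (fun u => P u /\ Q u).
Proof.
move=> iA [O1 [o1 n1 h1]] [O2 [o2 n2 h2]]; exists (O1 `&` O2).
split; [exact: openI|exact: irreducibleW|].
by move=> u Au [O1u O2u]; split; [exact: h1|exact: h2].
Qed.

Lemma irreducible_some_open_seq A (I : eqType) (r : seq I) (P : I -> U -> Prop) :
  irreducible A -> (forall i, i \in r -> on_some_open A (P i)) ->
  on_some_open A (fun u => forall i, i \in r -> P i u).
Proof.
move=> iA; elim: r => [|i r IH] hP.
  by exists setT; split=> //; [exact: openT|have [[a]] := iA; exists a].
have [l lr|O [oO nO hO]] :=
    irreducible_some_open_and iA (hP i (mem_head _ _)) (IH _).
  by apply: hP; rewrite inE lr orbT.
exists O; split=> // u Au Ou l.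
by have [Pi Pr] := hO u Au Ou; rewrite inE => /orP[/eqP->|/Pr].
Qed.

Lemma irreducibleI A O : irreducible A -> zariski_open O -> A `&` O !=set0 ->
  irreducible (A `&` O).
Proof.
move=> [nA iA] oO nAO; split=> // Z1 Z2 c1 c2 sZ.
have [||h|h] := iA Z1 (Z2 `|` ~` O) c1.
- exact: closedU.
- move=> a Aa; have [Oa|nOa] := pselect (O a); last by right; right.
  by have [z|z] := sZ a (conj Aa Oa); [left|right; left].
- by left=> a [/h].
- by right=> a [/h[]//].
Qed.

Lemma irreducible1 (a : U) : irreducible [set a].
Proof.
split=> [|Z1 Z2 _ _ sZ]; first by exists a.
by have [h|h] := sZ a erefl; [left|right] => _ ->.
Qed.

Definition zariski_closure A : set U :=
  \bigcap_(Z in [set Z | zariski_closed Z /\ A `<=` Z]) Z.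

Lemma closed_closure A : zariski_closed (zariski_closure A).
Proof. by apply: closed_bigcap => Z []. Qed.

Lemma sub_closure A : A `<=` zariski_closure A.
Proof. by move=> a Aa Z [_]; apply. Qed.

Lemma closure_sub A Z : zariski_closed Z -> A `<=` Z -> zariski_closure A `<=` Z.
Proof. by move=> cZ sZ a; apply. Qed.

(** The trace on A of the closure of an irreducible set is still irreducible, so maximality of Y
    applies. In other words, components are closed in A. *)
Lemma component_closure A Y : irreducible_component A Y ->
  A `&` zariski_closure Y = Y.
Proof.
move=> [sYA [nY iY] maxY]; apply: maxY; first split.
- by have [y Yy] := nY; exists y; split; [exact: sYA|exact: sub_closure].
- move=> Z1 Z2 c1 c2 sZ; have [|h|h] := iY Z1 Z2 c1 c2.
  + by move=> y Yy; apply: sZ; split; [exact: sYA|exact: sub_closure].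
  + by left=> y [_]; apply: closure_sub.
  + by right=> y [_]; apply: closure_sub.
- by move=> y [].
- by move=> y Yy; split; [exact: sYA|exact: sub_closure].
Qed.

Lemma irreducible_cover A (I : eqType) (r : seq I) (Z : I -> set U) :
  irreducible A -> (forall i, zariski_closed (Z i)) ->
  (forall a, A a -> exists2 i, i \in r & Z i a) ->
  exists2 i, i \in r & A `<=` Z i.
Proof.
move=> [[a Aa] iA] cZ.
(* B absorbs the members of the cover already treated, so that only two closed sets need to be
   separated at a time. *)
suff H (s : seq I) (B : set U) : zariski_closed B ->
    (forall b, A b -> B b \/ exists2 i, i \in s & Z i b) ->
    A `<=` B \/ exists2 i, i \in s & A `<=` Z i.
  move=> h; have [b /h|/(_ a Aa)|] := H r _ closed0 => //.
  by right.
elim: s B => [|i s IH] B cB h.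
  by left=> b /h[//|[]].
have [||h'|[l ls h']] := IH (B `|` Z i); first exact: closedU.
- move=> b /h[Bb|[l]]; first by left; left.
  by rewrite inE => /orP[/eqP-> Zb|ls Zb]; [left; right|right; exists l].
- have [|sZi] := iA _ _ cB (cZ i) h'; first by left.
  by right; exists i; rewrite ?mem_head.
- by right; exists l; rewrite // inE ls orbT.
Qed.

End ZariskiTopology.

Section ContinuousMaps.
Variables (F : fieldType) (U U' : vectType F).

Lemma closed_preimage (f : U -> U') Z :
  polymap f -> zariski_closed Z -> zariski_closed (f @^-1` Z).
Proof.
move=> pf [S ->].
rewrite (_ : _ @^-1` _ = \bigcap_(p in S) (f @^-1` [set u | peval p u = 0])).
  apply: closed_bigcap => p Sp.
  have [q hq] := polyfun_comp (polyfun_peval p) pf; exists [set q].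
  apply/seteqP; split=> u /=; last by move=> /(_ q erefl); rewrite -hq.
  by move=> hu r ->; rewrite -hq.
by apply/seteqP; split=> u /= hu p; apply: hu.
Qed.

Lemma open_preimage (f : U -> U') O :
  polymap f -> zariski_open O -> zariski_open (f @^-1` O).
Proof. by move=> pf oO; apply: (closed_preimage pf oO). Qed.

Lemma irreducible_image (f : U -> U') A :
  polymap f -> irreducible A -> irreducible (f @` A).
Proof.
move=> pf [[a Aa] iA]; split=> [|Z1 Z2 c1 c2 sZ]; first by exists (f a), a.
have [|h|h] := iA _ _ (closed_preimage pf c1) (closed_preimage pf c2).
- by move=> b Ab; apply: sZ; exists b.
- by left=> _ [b /h Zb <-].
- by right=> _ [b /h Zb <-].
Qed.

End ContinuousMaps.

(** * Irreducibility of products *)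

Section Products.
Variables (F : fieldType) (U U' : vectType F).

Lemma polymap_fst : polymap (fun p : U * U' => p.1).
Proof. by apply: polymap_linear. Qed.

Lemma polymap_pairl (b : U') : polymap (fun a : U => (a, b)).
Proof.
apply: (@polymap_ext _ _ _ (fun a => (a, 0) + (0, b))) => [a|].
  by rewrite /GRing.add /= /add_pair /= addr0 add0r.
apply: polymapD; last exact: polymap_cst.
apply: polymap_linear => c u v.
by congr pair => /=; rewrite scaler0 addr0.
Qed.

Lemma polymap_pairr (a : U) : polymap (fun b : U' => (a, b)).
Proof.
apply: (@polymap_ext _ _ _ (fun b => (a, 0) + (0, b))) => [b|].
  by rewrite /GRing.add /= /add_pair /= addr0 add0r.
apply: polymapD; first exact: polymap_cst.
apply: polymap_linear => c u v.
by congr pair => /=; rewrite scaler0 addr0.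
Qed.

(** Each slice {x} x B is irreducible, hence inside Z1 or Z2. The x whose slice lies in a given
    closed Z form a closed set, an intersection of preimages under x -> (x, y), so irreducibility of
    A decides. Only continuity of slice inclusions enters, which suits a topology finer than the
    product topology. *)
Lemma irreducible_prod (A : set U) (B : set U') : irreducible A ->
  irreducible B -> irreducible [set p : U * U' | A p.1 /\ B p.2].
Proof.
move=> [[a Aa] iA] [[b Bb] iB]; split=> [|Z1 Z2 c1 c2 sZ]; first by exists (a, b).
pose A_ (Z : set (U * U')) := \bigcap_(y in B) ((fun x => (x, y)) @^-1` Z).
have cA Z : zariski_closed Z -> zariski_closed (A_ Z).
  by move=> cZ; apply: closed_bigcap => y _;
    apply: closed_preimage (polymap_pairl y) cZ.
have [|h|h] := iA _ _ (cA _ c1) (cA _ c2).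
- move=> x Ax.
  have [|h|h] := iB _ _ (closed_preimage (polymap_pairr x) c1)
     (closed_preimage (polymap_pairr x) c2).
  + by move=> y By; apply: sZ.
  + by left=> y By; apply: h.
  + by right=> y By; apply: h.
- by left=> -[x y] [/= Ax By]; apply: h.
- by right=> -[x y] [/= Ax By]; apply: h.
Qed.

End Products.

Section Pairing.
Variables (F : fieldType) (U U' : vectType F).

Lemma polymap_pair (U'' : vectType F) (f : U -> U') (g : U -> U'') :
  polymap f -> polymap g -> polymap (fun u => (f u, g u)).
Proof.
move=> pf pg; apply: (@polymap_ext _ _ _ (fun u => (f u, 0) + (0, g u))) => [a|].
  by rewrite /GRing.add /= /add_pair /= addr0 add0r.
apply: polymapD; first exact: (polymap_comp (polymap_pairl (0 : U'')) pf).
exact: (polymap_comp (polymap_pairr (0 : U')) pg).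
Qed.

End Pairing.

Lemma irreducible_ffun (F : fieldType) (W : vectType F) n (Y : 'I_n -> set W) :
  (forall l, irreducible (Y l)) ->
  irreducible [set f : {ffun 'I_n -> W} | forall l, Y l (f l)].
Proof.
elim: n Y => [|n IH] Y iY.
  rewrite (_ : [set _ | _] = [set 0]); first exact: irreducible1.
  by apply/seteqP; split=> f /= _ => [|[]//]; apply/ffunP => -[].
pose h (p : {ffun 'I_n -> W} * W) : {ffun 'I_n.+1 -> W} :=
  [ffun l => if unlift ord_max l is Some l' then p.1 l' else p.2].
have ph : polymap h.
  apply: polymap_linear => a u v; apply/ffunP => l; rewrite !ffunE.
  by case: unlift => [l'|] //=; rewrite !ffunE.
have iP := irreducible_prod (IH (fun l => Y (lift ord_max l)) (fun l => iY _))
  (iY ord_max).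
rewrite (_ : [set _ | _] = h @` [set p : {ffun 'I_n -> W} * W |
   (forall l, Y (lift ord_max l) (p.1 l))
   /\ Y ord_max p.2]); first exact: irreducible_image.
apply/seteqP; split=> [f /= Yf|_ [[f w] /= [Yf Yw] <-] l].
  exists ([ffun l => f (lift ord_max l)], f ord_max).
    by split=> //= l; rewrite ffunE.
  by apply/ffunP => l; rewrite ffunE; case: unliftP => [l' ->|->] //=; rewrite ffunE.
by rewrite ffunE; case: unliftP => [l' ->|->] /=.
Qed.

(** * Local sections and semicontinuity of dimension *)

Section LocalSections.
Variables (F : fieldType) (U V : vectType F).
Implicit Types (D : set U) (S : U -> {vspace V}).

(* Every vector of a member of the family extends to a local polynomial
   section; this is what makes the dimension lower semicontinuous. *)
Definition has_sections D S : Prop :=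
  forall u v, D u -> v \in S u -> exists (f : U -> V) (O : set U),
    [/\ polymap f, zariski_open O, O u, f u = v &
        forall u', D u' -> O u' -> f u' \in S u'].

Lemma has_sectionsW D D' S : D' `<=` D -> has_sections D S -> has_sections D' S.
Proof.
move=> sD hS u v D'u Sv; have [f [O [pf oO Ou fu hf]]] := hS u v (sD _ D'u) Sv.
by exists f, O; split=> // u' /sD; apply: hf.
Qed.

Lemma has_sections_cst D (L : {vspace V}) : has_sections D (fun=> L).
Proof.
move=> u v _ Lv; exists (fun=> v), setT; split=> //; last exact: openT.
exact: polymap_cst.
Qed.

Lemma has_sectionsD D S1 S2 : has_sections D S1 -> has_sections D S2 ->
  has_sections D (fun u => (S1 u + S2 u)%VS).
Proof.
move=> h1 h2 u v Du /memv_addP[v1 Sv1 [v2 Sv2 ->]].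
have [f1 [O1 [pf1 o1 O1u fu1 hf1]]] := h1 u v1 Du Sv1.
have [f2 [O2 [pf2 o2 O2u fu2 hf2]]] := h2 u v2 Du Sv2.
exists (fun u => f1 u + f2 u), (O1 `&` O2).
split; [exact: polymapD|exact: openI|by []|by rewrite fu1 fu2|].
by move=> u' Du' [O1u' O2u']; apply: memv_add; [exact: hf1|exact: hf2].
Qed.

Lemma has_sections_sum D (I : eqType) (r : seq I) (S : I -> U -> {vspace V}) :
  (forall i, i \in r -> has_sections D (S i)) ->
  has_sections D (fun u => \sum_(i <- r) S i u)%VS.
Proof.
elim: r => [|i r IH] hS.
  rewrite (_ : (fun _ => _) = fun=> 0%VS); first exact: has_sections_cst.
  by apply/funext => u; rewrite big_nil.
rewrite (_ : (fun _ => _) = fun u => (S i u + \sum_(i <- r) S i u)%VS); last first.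
  by apply/funext => u; rewrite big_cons.
apply: has_sectionsD; first by apply: hS; rewrite mem_head.
by apply: IH => l lr; apply: hS; rewrite inE lr orbT.
Qed.

(** A basis of S u extends to local sections. Their coordinate matrix in that basis is the identity
    at u, so its determinant is nonzero nearby and the sections stay independent. *)
Lemma dim_lower_semicontinuous D S u : has_sections D S -> D u ->
  exists O, [/\ zariski_open O, O u &
    forall u', D u' -> O u' -> (\dim (S u) <= \dim (S u'))%N].
Proof.
move=> hS Du; set d := \dim (S u); pose X := vbasis (S u).
have fX : free X := basis_free (vbasisP (S u)).
have /choice[fO hfO] : forall i : 'I_d, exists fO : (U -> V) * set U,
    [/\ polymap fO.1, zariski_open fO.2, fO.2 u, fO.1 u = X`_i &
        forall u', D u' -> fO.2 u' -> fO.1 u' \in S u'].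
  move=> i; have SX : X`_i \in S u by apply: vbasis_mem; rewrite mem_nth ?size_tuple.
  by have [f [O h]] := hS u _ Du SX; exists (f, O).
(* [coord X] is defined on all of V, so M stays square where the sections leave S u, and a linear
   relation between them is still a relation between its rows. *)
pose M u' := \matrix_(i, k) coord X k ((fO i).1 u').
have pM : polyfun (fun u' => \det (M u')).
  apply: polyfun_det => i k.
  apply: (polyfun_ext (f := fun u' => coord X k ((fO i).1 u'))).
    by move=> u'; rewrite mxE.
  have [pf _ _ _ _] := hfO i; apply: (polyfun_comp (h := coord X k)) pf.
  by apply: polyfun_linear => a x y; rewrite linearP.
exists ([set u' | forall i, i \in index_enum 'I_d -> (fO i).2 u'] `&`
        [set u' | \det (M u') != 0]); split.
- apply: openI (open_neq0 pM); apply: open_bigcap_seq => i.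
  by have [] := hfO i.
- split=> [i _|/=]; first by have [] := hfO i.
  rewrite (_ : M u = 1%:M) ?det1 ?oner_eq0 //; apply/matrixP => i k.
  rewrite !mxE; have [_ _ _ -> _] := hfO i.
  by rewrite coord_free // eq_sym.
- move=> u' Du' [Ou' /= dM].
  pose Y := [tuple (fO i).1 u' | i < d].
  have fY : free Y.
    apply/freeP => a aY; pose A : 'rV_d := \row_i a i.
    have AM : A *m M u' = 0.
      apply/rowP => k; rewrite !mxE.
      transitivity (coord X k (\sum_(i < d) a i *: Y`_i)).
        rewrite linear_sum; apply: eq_bigr => i _.
        by rewrite linearZ !mxE (_ : Y`_i = (fO i).1 u') // -tnth_nth tnth_mktuple.
      by rewrite aY linear0.
    have A0 : A = 0.
      have uM : M u' \in unitmx by rewrite unitmxE unitfE.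
      by rewrite -[A](mulmxK uM) AM mul0mx.
    by move=> i; move/rowP/(_ i): A0; rewrite !mxE.
  have /eqP <- : \dim <<Y>> == d by rewrite -[X in _ == X](size_tuple Y).
  apply/dimvS/span_subvP => v /tnthP[i ->]; rewrite tnth_mktuple.
  by have [_ _ _ _] := hfO i; apply=> //; apply: Ou'; rewrite mem_index_enum.
Qed.

End LocalSections.

Lemma has_sections_pullback (F : fieldType) (U U' V : vectType F) (D : set U')
    (S : U' -> {vspace V}) (f : U -> U') :
  polymap f -> has_sections D S -> has_sections (f @^-1` D) (S \o f).
Proof.
move=> pf hS u v Du Sv; have [g [O [pg oO Ou gu hg]]] := hS _ _ Du Sv.
exists (g \o f), (f @^-1` O); split=> //.
- exact: polymap_comp.
- exact: open_preimage.
- by move=> u' Du' Ou'; apply: hg.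
Qed.

(** In a trivialisation, the constant section c through v gives w -> phi (w, c), which is only
    regular. Multiplying by its denominator, normalised to be 1 at x, makes it polynomial and keeps
    it in the linear space E w. *)
Lemma bundle_has_sections (F : fieldType) (W V : vectType F)
    (E : W -> {vspace V}) (X : set W) :
  embedded_vector_bundle E X -> has_sections X E.
Proof.
move=> hE x v Xx Ev; have [O [oO Ox]] := hE x Xx.
move=> [n [phi [psi [rphi rpsi lphi phiE psiK]]]].
pose c := psi (x, v); have phic : phi (x, c) = v by apply: psiK.
have [q [p [qx hqp]]] := rphi (x, c) (conj Xx Ox).
have pq (r : mpoly.mpoly (\dim {:(W * 'rV[F]_n)%type}) F) :
    polyfun (fun w : W => peval r (w, c)).
  exact: (polyfun_comp (polyfun_peval r) (polymap_pairl c)).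
have phiq w : X w -> O w -> peval q (w, c) != 0 ->
    \sum_l peval (p l) (w, c) *: (vbasis {:V})`_l = peval q (w, c) *: phi (w, c).
  move=> Xw Ow qw; rewrite [in RHS](coord_vbasis (memvf (phi (w, c)))).
  rewrite scaler_sumr; apply: eq_bigr => l _.
  by rewrite (hqp (w, c)) // scalerA mulrC divfK.
exists (fun w =>
  \sum_l ((peval q (x, c))^-1 * peval (p l) (w, c)) *: (vbasis {:V})`_l).
exists (O `&` [set w | peval q (w, c) != 0]).
have sE w : \sum_l ((peval q (x, c))^-1 * peval (p l) (w, c)) *: (vbasis {:V})`_l
   = (peval q (x, c))^-1 *: \sum_l peval (p l) (w, c) *: (vbasis {:V})`_l.
  by rewrite scaler_sumr; apply: eq_bigr => l _; rewrite scalerA.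
split.
- apply: polymap_sum => l; apply: polymap_scale; apply: polyfunM => //.
  exact: polyfun_cst.
- exact: openI (open_neq0 (pq q)).
- by [].
- by rewrite sE phiq // scalerA mulVf // scale1r.
- move=> w Xw [Ow qw]; rewrite sE phiq // !memvZ //.
  by have [] := phiE w c (conj Xw Ow).
Qed.

(** * Sequences of points depending linearly on a parameter *)

Section LinearSequences.
Variables (F : fieldType) (U W : vectType F).

(** A list of linear maps fixes the length independently of u, and concatenation and windows become
    operations on that list. *)
Definition linseq (g : U -> seq W) : Prop :=
  exists hs : seq 'Hom(U, W), forall u, g u = [seq (h : 'Hom(U, W)) u | h <- hs].

Lemma linseq_cat g1 g2 : linseq g1 -> linseq g2 -> linseq (fun u => g1 u ++ g2 u).
Proof.
by move=> [h1 e1] [h2 e2]; exists (h1 ++ h2) => u; rewrite map_cat e1 e2.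
Qed.

Lemma linseq_take m g : linseq g -> linseq (fun u => take m (g u)).
Proof. by move=> [h e]; exists (take m h) => u; rewrite map_take e. Qed.

Lemma linseq_drop m g : linseq g -> linseq (fun u => drop m (g u)).
Proof. by move=> [h e]; exists (drop m h) => u; rewrite map_drop e. Qed.

Lemma linseq_codom n (f : U -> {ffun 'I_n -> W}) :
  linear f -> linseq (fun u => codom (f u)).
Proof.
move=> lf.
have lfl l : linear (fun u => f u l) by move=> a u v; rewrite lf !ffunE.
pose g l : {linear U -> W} :=
  HB.pack (fun u => f u l)
    (GRing.isLinear.Build F U W *:%R (fun u => f u l) (lfl l)).
exists [seq linfun (g l) | l <- enum 'I_n] => u.
by rewrite -map_comp codomE; apply: eq_map => l; rewrite [RHS]lfunE.
Qed.

Lemma linseq_nth g l : linseq g -> linear (fun u => nth 0 (g u) l).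
Proof.
move=> [hs e] a u v; rewrite !e; have [lt|ge] := ltnP l (size hs).
  by rewrite !(nth_map 0) // linearP.
by rewrite !nth_default ?size_map // scaler0 addr0.
Qed.

Lemma has_sections_span (V : vectType F) (E : W -> {vspace V}) (X : set W) g :
  linseq g -> has_sections X E ->
  has_sections [set u | forall w, w \in g u -> X w] (fun u => span_fibers E (g u)).
Proof.
move=> [hs e] hE.
rewrite (_ : (fun _ => _) = fun u => (\sum_(h <- hs) E (h u))%VS); last first.
  by apply/funext => u; rewrite e /span_fibers big_map.
apply: has_sections_sum => h hh.
apply: has_sectionsW (has_sections_pullback (f := h) _ hE).
  by move=> u Xu; apply: Xu; rewrite e; apply/mapP; exists h.
by apply: polymap_linear => a u v; rewrite linearP.
Qed.

End LinearSequences.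

Section FfunOfSeq.
Variables (F : fieldType) (W : vectType F) (n : nat).

(** Sequences without a length in their type avoid casts between values of [size_type]. They become
    vectors only where the topology is needed. *)
Definition ffun_of_seq (xs : seq W) : {ffun 'I_n -> W} := [ffun l : 'I_n => xs`_l].

Lemma codom_ffun_of_seq xs : size xs = n -> codom (ffun_of_seq xs) = xs.
Proof.
move=> sn; apply: (@eq_from_nth _ 0); rewrite size_codom card_ord // => m mn.
rewrite codomE (nth_map (Ordinal mn)) ?size_enum_ord // ffunE.
by rewrite nth_enum_ord.
Qed.

Lemma polymap_ffun_of_seq (U : vectType F) (g : U -> seq W) :
  linseq g -> polymap (fun u => ffun_of_seq (g u)).
Proof.
move=> lg; apply: polymap_linear => a u v; apply/ffunP => l.
by rewrite !ffunE (linseq_nth _ lg).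
Qed.

End FfunOfSeq.

(** * Components and types of sequences *)

Section Apex.
Variables (F : fieldType) (W V : vectType F) (k : nat).
Variables (X : set W) (Xc : 'I_k -> set W) (E : W -> {vspace V}).
Hypothesis hXc : irreducible_components X Xc.
Hypothesis hE : has_sections X E.
Implicit Types (alpha : 'I_k -> nat) (xs ys us : seq W) (ms : seq (option 'I_k)).

Definition inX xs : Prop := forall w, w \in xs -> X w.

Definition only_in (c : 'I_k) (w : W) : Prop :=
  X w /\ forall i, Xc i w -> i = c.

(** [None] marks points outside X or on several components. A list of values free of [None] thus
    names one irreducible piece of the set of sequences of a type. *)
Definition comp (w : W) : option 'I_k := [pick c | `[< only_in c w >]].

Lemma Xc_sub i w : Xc i w -> X w.
Proof. by have [_ _ ->] := hXc; exists i. Qed.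

Lemma X_cover w : X w -> exists i, Xc i w.
Proof. by have [_ _ ->] := hXc => -[i _]; exists i. Qed.

Lemma only_in_Xc c w : only_in c w -> Xc c w.
Proof. by move=> [/X_cover[i Xi] h]; rewrite -(h i Xi). Qed.

Lemma compP w c : comp w = Some c <-> only_in c w.
Proof.
rewrite /comp; case: pickP => [c' /asboolP oc'|no].
  by split=> [[<-]//|oc]; rewrite (oc'.2 c (only_in_Xc oc)).
by split=> // oc; have := no c; rewrite asboolT.
Qed.

Lemma closure_Xc i w : X w -> zariski_closure (Xc i) w -> Xc i w.
Proof.
have [_ /(_ i)/component_closure e _] := hXc => Xw Cw.
have : (X `&` zariski_closure (Xc i)) w by [].
by rewrite e.
Qed.

(** Taking closures makes this set open in the ambient space. On X they add nothing, as each
    component is closed in X. *)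
Definition away_from_others (c : 'I_k) : set W :=
  [set w | forall i, i \in index_enum 'I_k -> 
    (if i == c then setT else ~` zariski_closure (Xc i)) w].

Lemma open_away c : zariski_open (away_from_others c).
Proof.
apply: open_bigcap_seq => i; case: eqP => _; first exact: openT.
by rewrite /zariski_open setCK; apply: closed_closure.
Qed.

Lemma away_only_in c w : X w -> away_from_others c w <-> only_in c w.
Proof.
move=> Xw; split=> [h|[_ h] i _].
  split=> // i Xi; have := h i (mem_index_enum i); case: eqP => // _.
  by case; apply: sub_closure.
by case: eqP => // ne /(closure_Xc Xw)/h.
Qed.

(** Otherwise the other components would cover X_c, so by irreducibility one of them would contain
    it, against maximality and distinctness. *)
Lemma only_in_nonempty c : exists w, only_in c w.
Proof.
apply: contrapT => no; have [injXc hc _] := hXc.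
have [sX iXc maxXc] := hc c.
have [||i + sXi] := @irreducible_cover _ _ _ _ [seq i <- index_enum 'I_k | i != c]
  (fun i => zariski_closure (Xc i)) iXc.
- by move=> i; apply: closed_closure.
- move=> w Xw; apply: contrapT => h; apply: no; exists w; split; first exact: sX.
  move=> i Xi; apply: contrapT => /eqP ne; apply: h; exists i.
    by rewrite mem_filter ne mem_index_enum.
  exact: sub_closure.
rewrite mem_filter => /andP[/eqP ne _]; apply: ne; apply: injXc.
have [sXi' iXi _] := hc i; apply: maxXc => //.
by move=> w Xw; apply: closure_Xc; [exact: sX|exact: sXi].
Qed.

Lemma irreducible_only_in c : irreducible [set w | only_in c w].
Proof.
have [_ /(_ c)[_ iXc _] _] := hXc.
rewrite (_ : [set _ | _] = Xc c `&` away_from_others c).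
  apply: irreducibleI => //; first exact: open_away.
  have [w ow] := only_in_nonempty c; exists w; split; first exact: only_in_Xc.
  by apply/(away_only_in _ ow.1).
apply/seteqP; split=> w /=; last by move=> [/Xc_sub Xw] /(away_only_in _ Xw).
by move=> ow; split; [exact: only_in_Xc|apply/(away_only_in _ ow.1)].
Qed.

Lemma nth_comps n (u : {ffun 'I_n -> W}) (l : 'I_n) :
  nth None (map comp (codom u)) l = comp (u l).
Proof.
rewrite (nth_map 0) ?size_codom ?card_ord // codomE (nth_map l) ?size_enum_ord //.
by rewrite nth_ord_enum.
Qed.

Lemma irreducible_comps n ms : size ms = n -> None \notin ms ->
  irreducible [set u : {ffun 'I_n -> W} | map comp (codom u) = ms].
Proof.
move=> sm nN; rewrite (_ : [set _ | _] =
    [set u : {ffun 'I_n -> W} | forall l, comp (u l) = nth None ms l]).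
  apply: (@irreducible_ffun _ _ _
    (fun l : 'I_n => [set w | comp w = nth None ms l])).
  move=> l; have /(mem_nth None) : (l < size ms)%N by rewrite sm.
  case E' : (nth None ms l) => [c|]; last by rewrite (negPf nN).
  have -> : [set w | comp w = Some c] = [set w | only_in c w].
    by apply/seteqP; split=> w /compP.
  by move=> _; apply: irreducible_only_in.
apply/seteqP; split=> u /= hu; first by move=> l; rewrite -hu nth_comps.
apply: (@eq_from_nth _ None); rewrite size_map size_codom card_ord // => l ln.
by rewrite (nth_comps u (Ordinal ln)) hu.
Qed.

Definition typed alpha xs : Prop :=
  None \notin map comp xs /\ forall i, count_mem (Some i) (map comp xs) = alpha i.

Lemma comps_inX xs : None \notin map comp xs -> inX xs.
Proof.
move=> nN w wx; case cw: (comp w) => [c|]; first by have [] := (compP w c).1 cw.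
by move: nN; rewrite -cw map_f.
Qed.

Lemma typed_inX alpha xs : typed alpha xs -> inX xs.
Proof. by move=> [/comps_inX]. Qed.

Lemma typed_comps alpha xs ys : map comp ys = map comp xs ->
  typed alpha xs -> typed alpha ys.
Proof. by rewrite /typed => ->. Qed.

Lemma typed_perm alpha xs ys : perm_eq xs ys -> typed alpha xs -> typed alpha ys.
Proof.
move=> /(perm_map comp) pxy [nN cx]; split; first by rewrite -(perm_mem pxy).
by move=> i; rewrite -cx; apply/esym/permP.
Qed.

Lemma typed_size alpha xs : typed alpha xs -> size xs = size_type alpha.
Proof.
move=> [nN cx]; rewrite /size_type -(eq_bigr _ (fun i _ => cx i)) -(size_map comp).
elim: (map comp xs) nN => [|m ms IH]; first by rewrite big1.
rewrite inE negb_or => /andP[nm /IH /= ->]; rewrite big_split /=.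
rewrite -addn1 addnC; congr (_ + _)%N; case: m nm => // c _.
by rewrite (bigD1 c) //= eqxx big1 // => i ic;
  rewrite (inj_eq Some_inj) eq_sym (negPf ic).
Qed.

Lemma typed_irreducible alpha xs : typed alpha xs ->
  irreducible [set u : {ffun 'I_(size_type alpha) -> W} |
    map comp (codom u) = map comp xs].
Proof.
move=> txs; apply: irreducible_comps txs.1.
by rewrite size_map; apply: typed_size.
Qed.

Lemma typed_cat alpha t j zs xs : map comp zs = nseq t (Some j) ->
  typed alpha xs -> typed (add_unit alpha t j) (zs ++ xs).
Proof.
move=> ez [nN cx]; split.
  by rewrite map_cat mem_cat negb_or nN ez mem_nseq andbF.
move=> i; rewrite map_cat count_cat cx ez count_nseq /add_unit addnC /=.
by rewrite (inj_eq Some_inj) eq_sym; case: eqP; rewrite ?mul1n ?mul0n.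
Qed.

Lemma typed_exists alpha : exists xs, typed alpha xs.
Proof.
have /choice[a ha] := only_in_nonempty.
have ca i : comp (a i) = Some i by apply/compP.
have mE : map comp (flatten [seq nseq (alpha i) (a i) | i <- enum 'I_k]) =
    flatten [seq nseq (alpha i) (Some i) | i <- enum 'I_k].
  by rewrite map_flatten -map_comp; congr flatten; apply: eq_map => i /=;
    rewrite map_nseq ca.
exists (flatten [seq nseq (alpha i) (a i) | i <- enum 'I_k]).
split=> [|i]; rewrite mE.
  by apply/negP => /flatten_mapP[i _]; rewrite mem_nseq andbF.
rewrite count_flatten -map_comp sumnE big_map big_enum /= (bigD1 i) //=.
rewrite count_nseq /= eqxx mul1n big1 ?addn0 // => l li.
by rewrite count_nseq /= (inj_eq Some_inj) (negPf li).
Qed.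

(** Equal types mean equal multiplicities of components, so the two component lists differ by a
    permutation. This moves a sequence into a prescribed irreducible piece without changing its
    span. *)
Lemma typed_align alpha xs ys : typed alpha xs -> typed alpha ys ->
  exists2 ys', perm_eq ys' ys & map comp ys' = map comp xs.
Proof.
move=> [nNx cx] [nNy cy].
have : perm_eq (map comp xs) (map comp ys).
  apply/allP => -[c|] _ /=; first by rewrite cx cy.
  by rewrite (count_memPn nNx) (count_memPn nNy).
move=> /(perm_iotaP None)[Is pI ->]; exists [seq nth 0 ys l | l <- Is].
  by rewrite -[X in perm_eq _ X](mkseq_nth 0) /mkseq perm_map // -(size_map comp).
rewrite -map_comp; apply/eq_in_map => l lI /=.
rewrite (nth_map 0) //; move: lI; rewrite (perm_mem pI) mem_iota size_map.
by case/andP.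
Qed.

Lemma of_typeP alpha (y : {ffun 'I_(size_type alpha) -> W}) :
  of_type Xc y <-> typed alpha (codom y).
Proof.
have cnt i : count_mem (Some i) (map comp (codom y)) =
    #|[set l | comp (y l) == Some i]%SET|.
  by rewrite codomE -map_comp count_map cardsE cardE size_filter enumT.
split=> [[h1 h2 h3]|[nN cx]].
  have cy l i : comp (y l) = Some i <-> Xc i (y l).
    split=> [/compP/only_in_Xc//|Xi]; apply/compP; split; first exact: Xc_sub Xi.
    by move=> i' Xi'; apply: h3 Xi' Xi.
  split=> [|i].
    apply/negP => /mapP[w /codomP[l ->]] e; have [i /cy] := h1 l.
    by rewrite -e.
  rewrite cnt -h2; apply: eq_card => l; rewrite !inE.
  by apply/eqP/asboolP => /cy.
have cy l : exists c, only_in c (y l).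
  case c: (comp (y l)) => [c'|]; first by exists c'; apply/compP.
  by move: nN; rewrite -c map_f // codom_f.
split=> [l|i|l i i' Xi Xi'].
- by have [c /only_in_Xc] := cy l; exists c.
- rewrite -cx cnt; apply: eq_card => l; rewrite !inE.
  apply/asboolP/eqP => [Xi|/compP/only_in_Xc//].
  by apply/compP; have [c [Xy h]] := cy l; rewrite (h _ Xi).
- by have [c [_ h]] := cy l; rewrite (h _ Xi) (h _ Xi').
Qed.

(** * Spans of fibres and partial apices *)

Local Notation span := (span_fibers E).

Lemma span_cat xs ys : span (xs ++ ys) = (span xs + span ys)%VS.
Proof. exact: big_cat. Qed.

Lemma span_perm xs ys : perm_eq xs ys -> span xs = span ys.
Proof. exact: perm_big. Qed.

(** The fixed summand L stands for fibres at points that do not move, for a line <v> that has to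
    stay outside the span, or for both. *)
Lemma span_nearby_linseq (U : vectType F) (g : U -> seq W) us (L : {vspace V}) u0 :
  linseq g -> inX (g u0) -> exists O : set U, [/\ zariski_open O, O u0 &
    forall u, inX (g u) -> O u ->
      (\dim (span (us ++ g u0) + L) <= \dim (span (us ++ g u) + L))%N].
Proof.
move=> lg Xg.
have hs : has_sections [set u | inX (g u)] (fun u => span us + span (g u) + L)%VS.
  apply: has_sectionsD (@has_sections_cst _ _ _ _ L).
  apply: has_sectionsD (@has_sections_cst _ _ _ _ _) _.
  exact: has_sections_span.
have [O [oO Ou0 hO]] := dim_lower_semicontinuous hs Xg.
by exists O; split=> // u Xu Ou; rewrite !span_cat; apply: hO.
Qed.

Lemma span_nearby us (L : {vspace V}) n ys : size ys = n -> inX ys ->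
  exists O : set {ffun 'I_n -> W}, [/\ zariski_open O, O (ffun_of_seq n ys) &
    forall u : {ffun 'I_n -> W}, inX (codom u) -> O u ->
      (\dim (span (us ++ ys) + L) <= \dim (span (us ++ codom u) + L))%N].
Proof.
move=> sy Xy.
have lc : linseq (fun u : {ffun 'I_n -> W} => codom u) by apply: linseq_codom.
have := span_nearby_linseq us L lc (u0 := ffun_of_seq n ys).
by rewrite codom_ffun_of_seq //; apply.
Qed.

Lemma exists_max_dim (T : Type) (P : T -> Prop) (f : T -> {vspace V}) :
  (exists x, P x) ->
  exists2 x, P x & forall x', P x' -> (\dim (f x') <= \dim (f x))%N.
Proof.
move=> [x0 Px0]; pose Q d := `[< exists2 x, P x & \dim (f x) = d >].
have exQ : exists d, Q d by exists (\dim (f x0)); apply/asboolP; exists x0.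
have ubQ d : Q d -> (d <= \dim {:V})%N.
  by move=> /asboolP[x _ <-]; apply/dimvS/subvf.
case: (ex_maxnP exQ ubQ) => d /asboolP[x Px <-] maxd.
by exists x => // x' Px'; apply: maxd; apply/asboolP; exists x'.
Qed.

Definition max_typed alpha us ys : Prop :=
  typed alpha ys /\
  forall ys', typed alpha ys' ->
    (\dim (span (us ++ ys')) <= \dim (span (us ++ ys)))%N.

Lemma max_typed_exists alpha us : exists ys, max_typed alpha us ys.
Proof.
have [ys tys mys] := exists_max_dim (fun ys => span (us ++ ys)) (typed_exists alpha).
by exists ys.
Qed.

Lemma max_typed_perm alpha us ys ys' : perm_eq ys ys' ->
  max_typed alpha us ys -> max_typed alpha us ys'.
Proof.
move=> p [tys my]; split; first exact: typed_perm tys.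
move=> zs /my; rewrite (span_perm (_ : perm_eq (us ++ ys) (us ++ ys'))) //.
by rewrite perm_cat2l.
Qed.

(** Reaching the maximal dimension is an open condition by semicontinuity, and rearranging [ys]
    shows that it is met on every irreducible piece; hence it holds on a dense open set. *)
Lemma generic_dim_max alpha us ys : max_typed alpha us ys ->
  generic_dim Xc E alpha us = \dim (span (us ++ ys)).
Proof.
move=> [tys my]; apply: generic_value_eq.
  exists (ffun_of_seq _ ys); apply/of_typeP.
  by rewrite codom_ffun_of_seq //; apply: typed_size.
apply: generically_local => O' oO' [y0 [/of_typeP t0 O'y0]].
have [ys' py cy] := typed_align t0 tys.
have ty' : typed alpha ys' by apply: typed_comps t0.
have sy' := typed_size ty'.
have [O [oO Oy hO]] := span_nearby us 0%VS sy' (typed_inX ty').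
have [||u [cu [Ou O'u]]] := irreducibleW (typed_irreducible t0) oO oO'.
- by exists (ffun_of_seq _ ys'); split; rewrite //= codom_ffun_of_seq.
- by exists y0.
exists O; split=> //.
  exists u; split=> //; split=> //; apply/of_typeP.
  exact: typed_comps t0.
move=> v /of_typeP tv Ov; apply/eqP; rewrite eqn_leq my //=.
have := hO v (typed_inX tv) Ov; rewrite !addv0.
by rewrite (span_perm (_ : perm_eq (us ++ ys') (us ++ ys))) // perm_cat2l.
Qed.

Lemma apexP alpha us v : v \in apex Xc E alpha us <->
  forall ys, max_typed alpha us ys -> v \in span (us ++ ys).
Proof.
have [zs mzs] := max_typed_exists alpha us.
split=> [/memv_bigcap h ys mys|h].
  have sy := typed_size mys.1; apply: h.
  exists (ffun_of_seq _ ys).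
    by apply/of_typeP; rewrite codom_ffun_of_seq //; case: mys.
  by rewrite codom_ffun_of_seq // (generic_dim_max mys).
apply/memv_bigcap => _ [y /of_typeP ty [dy ->]]; apply: h; split=> // ys' ty'.
by rewrite dy (generic_dim_max mzs); apply: mzs.2.
Qed.

Lemma dim_add_line (L : {vspace V}) v : v \notin L -> (\dim L < \dim (L + <[v]>))%N.
Proof.
move=> vL; rewrite ltnNge; apply: contra vL => le.
have /eqP -> : L == (L + <[v]>)%VS by rewrite eqEdim addvSl.
exact: (subvP (addvSr L _)) (memv_line v).
Qed.

Lemma add_line (L : {vspace V}) v : v \in L -> (L + <[v]>)%VS = L.
Proof. by move=> vL; apply/addv_idPl; rewrite -memvE. Qed.

(** If v were outside some maximal span over us', it would stay outside for a nearby u that is also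
    maximal over us. But then v lies in the span over us, which is contained in the one over us'. *)
Lemma apex_mono alpha us ex us' : perm_eq us' (us ++ ex) ->
  (apex Xc E alpha us <= apex Xc E alpha us')%VS.
Proof.
move=> pu; apply/subvP => v /apexP vus; apply/apexP => ys mys.
apply: contrapT => /negP vn.
have [zs0 mzs0] := max_typed_exists alpha us.
(* Aligning with [ys] puts both neighbourhoods on the same irreducible piece, where they must
   meet. *)
have [zs pz cz] := typed_align mys.1 mzs0.1.
have mzs : max_typed alpha us zs by apply: max_typed_perm mzs0; rewrite perm_sym.
have sy := typed_size mys.1; have sz := typed_size mzs.1.
have [O1 [o1 O1y h1]] := span_nearby us' <[v]> sy (typed_inX mys.1).
have [O2 [o2 O2z h2]] := span_nearby us 0%VS sz (typed_inX mzs.1).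
have [||u [cu [O1u O2u]]] := irreducibleW (typed_irreducible mys.1) o1 o2.
- by exists (ffun_of_seq _ ys); split; rewrite //= codom_ffun_of_seq.
- by exists (ffun_of_seq _ zs); split; rewrite //= codom_ffun_of_seq.
have tu : typed alpha (codom u) by apply: typed_comps mys.1.
have vu : v \in span (us ++ codom u).
  apply: vus; split=> // ys' ty'; apply: leq_trans (mzs.2 _ ty') _.
  by have := h2 u (typed_inX tu) O2u; rewrite !addv0.
have vu' : v \in span (us' ++ codom u).
  apply: subvP vu; rewrite !span_cat (span_perm pu) span_cat.
  by rewrite addvS ?addvSl.
have := h1 u (typed_inX tu) O1u; rewrite (add_line vu') leqNgt.
by rewrite (leq_ltn_trans (mys.2 _ tu)) // dim_add_line.
Qed.

(** * Exchanging z for z' *)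

Lemma split_typed alpha s j ys : typed (add_unit alpha s j) ys ->
  exists zs us, [/\ perm_eq (zs ++ us) ys, map comp zs = nseq s (Some j) &
    typed alpha us].
Proof.
have [us0 tus0] := typed_exists alpha; have [a /compP ca] := only_in_nonempty j.
have cz : map comp (nseq s a) = nseq s (Some j) by rewrite map_nseq ca.
move=> /(typed_align (typed_cat cz tus0))[ys' py cy].
exists (take s ys'), (drop s ys'); rewrite cat_take_drop; split=> //.
  by rewrite map_take cy map_cat cz take_size_cat // size_nseq.
apply: typed_comps tus0.
by rewrite map_drop cy map_cat cz drop_size_cat // size_nseq.
Qed.

Lemma apex_windows_eq alpha (L : {vspace V}) xs ws s b : size ws = (s + s)%N ->
  let win r t := (apex Xc E alpha (xs ++ take r (drop t ws)) :&: L)%VS in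
  (forall t, (t <= s)%N -> \dim (win s t) = b) ->
  (forall t, (t < s)%N -> \dim (win s.+1 t) = b) ->
  win s 0 = win s s.
Proof.
move=> sw win h h1.
suff H t : (t <= s)%N -> win s 0 = win s t by apply: H.
elim: t => // t IH ts; rewrite IH; last exact: ltnW.
have lt : (t < size ws)%N by rewrite sw ltn_addl // ltnW.
have sub r t' : (apex Xc E alpha (xs ++ take s (drop t' ws)) <=
    apex Xc E alpha (xs ++ take s.+1 (drop r ws)))%VS ->
    (t' <= s)%N -> (r < s)%N -> win s t' = win s.+1 r.
  by move=> sa ht' hr; apply/eqP; rewrite eqEdim h // h1 // leqnn andbT;
    apply: capvS.
rewrite (sub t) //; last exact: ltnW.
  rewrite -(sub t t.+1) //; apply: (@apex_mono _ _ [:: nth 0 ws t]).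
  by rewrite -catA perm_cat2l (drop_nth 0 lt) /= cats1 perm_sym perm_rcons.
(* The window at t lacks the last entry of the longer one, which exists since t < s and [ws] has
   length 2s. *)
apply: (@apex_mono _ _ [:: nth 0 (drop t ws) s]).
rewrite -catA perm_cat2l cats1 (take_nth 0) //.
by rewrite size_drop sw ltn_subRL ltn_add2r.
Qed.

(** N is the maximal dimension over xs for type alpha + s e_j, and it is already reached with [zs]
    as the added points of X_j. O is the set of u for which [zs] can be exchanged for u. *)
Lemma apex_add_unit_eq alpha s j (L : {vspace V}) xs zs b N
    (O : set {ffun 'I_s -> W}) :
  map comp zs = nseq s (Some j) ->
  (forall zs' us, map comp zs' = nseq s (Some j) -> typed alpha us ->
     (\dim (span (xs ++ zs' ++ us)) <= N)%N) ->
  (exists2 us, typed alpha us & (N <= \dim (span (xs ++ zs ++ us)))%N) ->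
  zariski_open O ->
  [set u : {ffun 'I_s -> W} | map comp (codom u) = nseq s (Some j)] `&` O !=set0 ->
  (forall u : {ffun 'I_s -> W}, map comp (codom u) = nseq s (Some j) -> O u ->
     (forall t, (t <= s)%N ->
       \dim (apex Xc E alpha (xs ++ take s (drop t (zs ++ codom u))) :&: L) = b) /\
     (forall t, (t < s)%N ->
       \dim (apex Xc E alpha
         (xs ++ take s.+1 (drop t (zs ++ codom u))) :&: L) = b)) ->
  (apex Xc E alpha (xs ++ zs) :&: L = apex Xc E (add_unit alpha s j) xs :&: L)%VS.
Proof.
move=> cz maxN [us1 tus1 N1] oO nO hO.
have sz : size zs = s by rewrite -(size_map comp) cz size_nseq.
have dimN ys : typed (add_unit alpha s j) ys -> (\dim (span (xs ++ ys)) <= N)%N.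
  move=> /split_typed[zs' [us [p cz' tus]]];
    rewrite -(span_perm (_ : perm_eq (xs ++ zs' ++ us) _)).
    exact: maxN.
  by rewrite perm_cat2l.
have iZ : irreducible
    [set u : {ffun 'I_s -> W} | map comp (codom u) = nseq s (Some j)].
  by apply: irreducible_comps; rewrite ?size_nseq // mem_nseq andbF.
have nN m : None \notin nseq m (Some j) by rewrite mem_nseq andbF.
apply/eqP; rewrite eqEsubv !subv_cap !capvSr !andbT; apply/andP; split; last first.
  (* If [us] is maximal over xs ++ zs, then zs ++ us reaches N and is maximal over xs. *)
  apply: subv_trans (capvSl _ _) _; apply/subvP => v /apexP hv.
  apply/apexP => us [tus mus]; rewrite -catA; apply: hv.
  split=> [|ys /dimN dys]; first exact: typed_cat.
  apply: leq_trans dys (leq_trans N1 _); rewrite !catA; exact: mus.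
apply/subvP => v; rewrite memv_cap => /andP[vz vL]; apply/apexP => ys mys.
have [zs0 [us [p cz0 tus]]] := split_typed mys.1.
have py : perm_eq (xs ++ ys) (xs ++ zs0 ++ us) by rewrite perm_cat2l perm_sym.
have eN : \dim (span (xs ++ ys)) = N.
  apply/eqP; rewrite eqn_leq dimN ?(leq_trans N1) //; last exact: mys.1.
  by apply: mys.2; apply: typed_cat.
rewrite (span_perm py); apply: contrapT => /negP vn.
have sz0 : size zs0 = s by rewrite -(size_map comp) cz0 size_nseq.
have Xz0 : inX zs0 by apply: comps_inX; rewrite cz0.
(* [zs0] may be special. It is moved to a nearby u in O; [h1] preserves the dimension N of the span,
   and [h2] the extra dimension contributed by v. *)
have [O1 [o1 O1z h1]] := span_nearby xs (span us) sz0 Xz0.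
have [O2 [o2 O2z h2]] := span_nearby xs (span us + <[v]>) sz0 Xz0.
have [||u [cu [Ou [O1u O2u]]]] := irreducibleW iZ oO (openI o1 o2) => //.
  by exists (ffun_of_seq _ zs0); split; rewrite //= codom_ffun_of_seq.
have Xu : inX (codom u) by apply: comps_inX; rewrite cu.
have su : size (codom u) = s by rewrite size_codom card_ord.
have [ws ws1] := hO u cu Ou.
have szu : size (zs ++ codom u) = (s + s)%N by rewrite size_cat sz su.
have := apex_windows_eq szu ws ws1.
rewrite drop0 take_size_cat // drop_size_cat // take_oversize ?su // => eqw.
have : v \in (apex Xc E alpha (xs ++ codom u) :&: L)%VS by rewrite -eqw memv_cap vz.
rewrite memv_cap => /andP[/apexP vu _].
have d1 : (N <= \dim (span ((xs ++ codom u) ++ us)))%N.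
  rewrite -eN (span_perm py) !span_cat addvA -!span_cat.
  by have := h1 u Xu O1u; rewrite -!span_cat.
have vs : v \in span ((xs ++ codom u) ++ us).
  apply: vu; split=> // us' tus'; apply: leq_trans d1.
  by rewrite -catA; apply: maxN.
(* The left side of [h2] is at least N + 1 since v is outside the span at [zs0]; the right side is
   at most N since v is in the span at u. *)
have := h2 u Xu O2u; rewrite !addvA -!span_cat (add_line vs) -catA leqNgt.
rewrite (leq_ltn_trans _ (dim_add_line vn)) //.
rewrite -(span_perm py) eN -catA; exact: maxN.
Qed.

(** Within X, lying on X_c alone is an open condition. Such open sets cut single irreducible pieces
    out of the set of sequences of a type. *)
Lemma open_comps n ms : size ms = n -> None \notin ms ->
  exists O : set {ffun 'I_n -> W}, zariski_open O /\
    forall u : {ffun 'I_n -> W}, inX (codom u) -> O u <-> map comp (codom u) = ms.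
Proof.
move=> sm nN.
exists [set u : {ffun 'I_n -> W} | forall l, l \in index_enum 'I_n ->
  (if nth None ms l is Some c
   then [set u : {ffun 'I_n -> W} | away_from_others c (u l)]
   else setT) u]; split=> [|u Xu].
  apply: open_bigcap_seq => l; case: (nth None ms l) => [c|]; last exact: openT.
  apply: (open_preimage (f := fun u : {ffun 'I_n -> W} => u l)) (open_away c).
  by apply: polymap_linear => a u v; rewrite !ffunE.
split=> [hu|<- l _].
  apply: (@eq_from_nth _ None); rewrite size_map size_codom card_ord // => l ln.
  rewrite (nth_comps u (Ordinal ln)) /=.
  have := hu (Ordinal ln) (mem_index_enum _) => /=.
  have : nth None ms l \in ms by rewrite mem_nth // sm.
  case: (nth None ms l) => [c _|]; last by rewrite (negPf nN).
  by move=> /away_only_in oc; apply/compP/oc; apply: Xu; rewrite codom_f.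
rewrite nth_comps; case c: (comp (u l)) => [c'|] //=.
by apply/away_only_in; [apply: Xu; rewrite codom_f|apply/compP].
Qed.

(** * Windows of general sequences are general *)

Section Windows.
Variables (alpha beta : 'I_k -> nat) (i j : 'I_k) (s : nat) (xs0 : seq W).
Hypothesis txs0 : typed beta xs0.

Local Notation point :=
  ({ffun 'I_(size_type beta) -> W} * {ffun 'I_s -> W} * W)%type.

Definition pieces : set (point * {ffun 'I_s -> W}) :=
  [set q : point * {ffun 'I_s -> W} |
          [/\ map comp (codom q.1.1.1) = map comp xs0,
               map comp (codom q.1.1.2) = nseq s (Some j),
               Xc i q.1.2 & map comp (codom q.2) = nseq s (Some j)]].

Definition window r t (q : point * {ffun 'I_s -> W}) : seq W :=
  take r (drop t (codom q.1.1.2 ++ codom q.2)).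

(** Keeping x, one window and y defines a linear map from [pieces] onto a full piece of the pairs of
    type beta + r e_j with a point of X_i. A dense open set meets that piece, so its preimage is
    nonempty. *)
Lemma generic_on_windows r t (b : nat) : (t + r <= s + s)%N ->
  generically
    [set p : {ffun 'I_(size_type (add_unit beta r j)) -> W} * W |
       of_type Xc p.1 /\ Xc i p.2]
    (fun p => \dim (apex Xc E alpha (codom p.1) :&: E p.2) = b) ->
  on_some_open pieces (fun q =>
    \dim (apex Xc E alpha (codom q.1.1.1 ++ window r t q) :&: E q.1.2) = b).
Proof.
move=> trs [O1 [o1 dO1 hO1]]; set B := size_type beta.
set n := size_type (add_unit beta r j) in O1 o1 dO1 hO1 *.
have [a /compP ca] := only_in_nonempty j.
have ctyped xs : map comp xs = map comp xs0 ++ nseq r (Some j) ->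
    typed (add_unit beta r j) xs.
  move=> cx; apply: (typed_comps (xs := xs0 ++ nseq r a)).
    by rewrite cx map_cat map_nseq ca.
  apply: (typed_perm (xs := nseq r a ++ xs0)); first by rewrite perm_catC.
  by apply: typed_cat; rewrite ?map_nseq ?ca.
have nN m : None \notin nseq m (Some j) by rewrite mem_nseq andbF.
have sms : size (map comp xs0 ++ nseq r (Some j)) = n.
  rewrite /n -(typed_size (ctyped (xs0 ++ nseq r a) _)) ?map_cat ?map_nseq ?ca //.
  by rewrite !size_cat size_map !size_nseq.
have sx0 : size xs0 = B by apply: typed_size.
have [|Oc [oc hOc]] := open_comps sms.
  by rewrite mem_cat negb_or nN andbT; case: txs0.
pose f (q : point * {ffun 'I_s -> W}) :=
  (ffun_of_seq n (codom q.1.1.1 ++ window r t q), q.1.2).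
have pf : polymap f.
  apply: polymap_pair; last by apply: polymap_linear.
  apply: polymap_ffun_of_seq; apply: linseq_cat; first by apply: linseq_codom.
  apply: linseq_take; apply: linseq_drop.
  by apply: linseq_cat; apply: linseq_codom.
have comps_f q : pieces q ->
    map comp (codom q.1.1.1 ++ window r t q) = map comp xs0 ++ nseq r (Some j).
  move=> [cx cz _ cz']; rewrite map_cat cx map_take map_drop map_cat cz cz'.
  by rewrite -nseqD drop_nseq take_nseq // leq_subRL // (leq_trans (leq_addr r t)).
exists (f @^-1` O1); split.
- exact: open_preimage.
(* Density is tested against [Oc], which selects the sequences whose components are those of [xs0]
   followed by r times j. *)
- have [||p [[[tp Xp] O1p] Ocp]] := dO1 (fst @^-1` Oc).
  + exact: open_preimage (@polymap_fst _ _ _) oc.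
  + have iXc : irreducible (Xc i) by have [_ /(_ i)[]] := hXc.
    have [[y Xy] _] := iXc.
    have cz : map comp (xs0 ++ nseq r a) = map comp xs0 ++ nseq r (Some j).
      by rewrite map_cat map_nseq ca.
    have sz : size (xs0 ++ nseq r a) = n by rewrite -sms -cz size_map.
    exists (ffun_of_seq n (xs0 ++ nseq r a), y); split=> /=; last first.
      have tz := ctyped _ cz.
      by apply/hOc; rewrite codom_ffun_of_seq //; apply: typed_inX tz.
    split=> //=; apply/of_typeP; rewrite codom_ffun_of_seq //; exact: ctyped.
  + have tp' := (of_typeP p.1).1 tp.
    have cp := (hOc p.1 (typed_inX tp')).1 Ocp.
    set us := codom p.1 in cp tp'.
    have su : size us = n by rewrite size_codom card_ord.
    (* To lift p, its last r points are placed at positions t to t + r - 1 and the rest of (z, z')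
       is padded with a point lying on X_j alone. *)
    pose Z := nseq t a ++ drop B us ++ nseq (s + s - (t + r)) a.
    have sB : size (map comp xs0) = B by rewrite size_map.
    have cd : map comp (drop B us) = nseq r (Some j).
      by rewrite map_drop cp drop_size_cat.
    have sd : size (drop B us) = r by rewrite -(size_map comp) cd size_nseq.
    have cZ : map comp Z = nseq (s + s) (Some j).
      rewrite !map_cat cd !map_nseq ca -!nseqD addnA subnKC //.
    have sZ : size Z = (s + s)%N by rewrite -(size_map comp) cZ size_nseq.
    have stB : size (take B us) = B.
      by rewrite -(size_map comp) map_take cp take_size_cat.
    have stZ : size (take s Z) = s by rewrite size_takel // sZ leq_addr.
    have sdZ : size (drop s Z) = s by rewrite size_drop sZ addnK.
    exists (ffun_of_seq B (take B us), ffun_of_seq s (take s Z), p.2,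
            ffun_of_seq s (drop s Z)); split.
      split; rewrite /= ?codom_ffun_of_seq //.
      * by rewrite map_take cp take_size_cat.
      * by rewrite map_take cZ take_nseq // leq_addr.
      * by rewrite map_drop cZ drop_nseq addnK.
    rewrite /= /f /window /= !codom_ffun_of_seq // cat_take_drop.
    rewrite drop_size_cat ?size_nseq // take_size_cat // cat_take_drop.
    rewrite (_ : ffun_of_seq n us = p.1); first by case: (p) O1p.
    by apply/ffunP => l; rewrite ffunE /us codomE (nth_map l) ?size_enum_ord //
      nth_ord_enum.
- move=> q Aq O1q.
  have cq := comps_f q Aq.
  have sq : size (codom q.1.1.1 ++ window r t q) = n by rewrite -(size_map comp) cq.
  have := hO1 _ _ O1q; rewrite /f /= codom_ffun_of_seq //; apply.
  split; last by case: Aq.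
  by apply/of_typeP; rewrite /= codom_ffun_of_seq //; apply: ctyped.
Qed.

End Windows.

(** * The equality at general points *)

Lemma generic_apex_eq alpha beta (i j : 'I_k) s :
  let b t := bnum Xc E alpha (add_unit beta t j) i in
  b s <> 0%N -> b s = b s.+1 ->
  generically
    [set p : {ffun 'I_(size_type beta) -> W} * {ffun 'I_s -> W} * W |
      [/\ of_type Xc p.1.1, forall l, Xc j (p.1.2 l) & Xc i p.2]]
    (fun p => (apex Xc E alpha (codom p.1.1 ++ codom p.1.2) :&: E p.2 =
      apex Xc E (add_unit alpha s j) (codom p.1.1) :&: E p.2)%VS).
Proof.
move=> b bs0 bs1.
have gen t : b t <> 0%N -> generically
    [set p : {ffun 'I_(size_type (add_unit beta t j)) -> W} * W |
       of_type Xc p.1 /\ Xc i p.2]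
    (fun p => \dim (apex Xc E alpha (codom p.1) :&: E p.2) = b t).
  exact: generic_valueP.
have gs := gen s bs0.
have gs1 := gen s.+1; rewrite -bs1 in gs1; have {}gs1 := gs1 bs0.
apply: generically_local => O' oO' [[[x0 z0] y0] [[/of_typeP tx0 Xz0 Xy0] O'0]].
rewrite /= in tx0 Xz0 Xy0.
have nN m : None \notin nseq m (Some j) by rewrite mem_nseq andbF.
have iXc c : irreducible (Xc c) by have [_ /(_ c)[]] := hXc.
have iX := typed_irreducible tx0.
have iZ : irreducible
    [set u : {ffun 'I_s -> W} | map comp (codom u) = nseq s (Some j)].
  by apply: irreducible_comps; rewrite ?size_nseq.
have iZX : irreducible [set u : {ffun 'I_s -> W} | forall l, Xc j (u l)].
  exact: (irreducible_ffun (fun=> iXc j)).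
have iP := irreducible_prod (irreducible_prod (irreducible_prod iX iZ) (iXc i)) iZ.
have iP' := irreducible_prod (irreducible_prod iX iZX) (iXc i).
set A' := [set q | _] in iP.
have A'E : A' = @pieces beta i j s (codom x0).
  by apply/seteqP; split=> q; [case=> [[[]]]|case].
have [Oz [oz hOz]] : exists O : set {ffun 'I_s -> W}, zariski_open O /\
    forall u : {ffun 'I_s -> W}, inX (codom u) ->
      O u <-> map comp (codom u) = nseq s (Some j).
  by apply: open_comps; rewrite ?size_nseq.
have [Ox [ox hOx]] : exists O : set {ffun 'I_(size_type beta) -> W},
    zariski_open O /\
    forall u : {ffun 'I_(size_type beta) -> W}, inX (codom u) ->
      O u <-> map comp (codom u) = map comp (codom x0).
  by apply: open_comps tx0.1; rewrite size_map; apply: typed_size.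
have XzX (u : {ffun 'I_s -> W}) : (forall l, Xc j (u l)) -> inX (codom u).
  by move=> hu w /codomP[l ->]; apply: Xc_sub (hu l).
have [u cu] := iZ.1.
have Xu : inX (codom u) by apply: comps_inX; rewrite cu.
have ouj l : Xc j (u l).
  apply: only_in_Xc; apply/compP.
  have : comp (u l) \in nseq s (Some j) by rewrite -cu map_f // codom_f.
  by case/nseqP.
pose point := ({ffun 'I_(size_type beta) -> W} * {ffun 'I_s -> W} * W)%type.
have pz : polymap (fun p : point => p.1.2) by apply: polymap_linear.
have px : polymap (fun p : point => p.1.1) by apply: polymap_linear.
(* Entries of [z0] may lie on several components. As X_j^s is irreducible, a point of O' can be
   found whose z has all entries on X_j alone. *)
have [||p1 [[[cx1 Xz1] Xy1] [Ozp1 O'p1]]] :=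
    irreducibleW iP' (open_preimage pz oz) oO'.
- exists (x0, u, y0); split=> //=; exact/hOz.
- by exists (x0, z0, y0).
have cz1 := (hOz _ (XzX _ Xz1)).1 Ozp1.
(* N is maximal with x and z varying too, so the single sequence [um] reaches it at all (x, z) in an
   open set. *)
have [[[xm zm] um] /= [cxm czm tum] maxN] := exists_max_dim
  (P := fun w : {ffun 'I_(size_type beta) -> W} * {ffun 'I_s -> W} * seq W =>
    [/\ map comp (codom w.1.1) = map comp (codom x0),
        map comp (codom w.1.2) = nseq s (Some j) & typed alpha w.2])
  (fun w => span (codom w.1.1 ++ codom w.1.2 ++ w.2))
  (let: ex_intro us tus := typed_exists alpha in
    ex_intro _ (x0, u, us) (And3 erefl cu tus)).
rewrite /= in maxN; set N := \dim (span (codom xm ++ _)) in maxN.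
have lg : linseq (fun p : point => codom p.1.1 ++ codom p.1.2).
  by apply: linseq_cat; apply: linseq_codom; move=> ? ? ?.
have Xcat (x : {ffun 'I_(size_type beta) -> W}) (z : {ffun 'I_s -> W}) :
    map comp (codom x) = map comp (codom x0) ->
    map comp (codom z) = nseq s (Some j) -> inX (codom x ++ codom z).
  move=> cx cz; apply: comps_inX; rewrite map_cat cx cz mem_cat negb_or nN andbT.
  exact: tx0.1.
have [|Om [om Omm hOm]] :=
    span_nearby_linseq [::] (span um) (u0 := (xm, zm, y0) : point) lg.
  exact: Xcat.
(* There are s + 1 windows of length s and s of length s + 1: finitely many conditions on an
   irreducible set. *)
have [Ow [ow nOw hOw]] : on_some_open A' (fun q =>
   (forall t, t \in iota 0 s.+1 ->
      \dim (apex Xc E alpha (codom q.1.1.1 ++ window s t q) :&: E q.1.2) = b s) /\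
   (forall t, t \in iota 0 s ->
      \dim (apex Xc E alpha (codom q.1.1.1 ++ window s.+1 t q) :&: E q.1.2) = b s)).
  rewrite A'E in iP *; apply: irreducible_some_open_and => //;
    apply: irreducible_some_open_seq => // t; rewrite mem_iota add0n /= => ts;
    apply: generic_on_windows => //.
    by rewrite leq_add2r -ltnS.
  by rewrite addnS -addSn leq_add2r.
have pfst : polymap (fun q : point * {ffun 'I_s -> W} => q.1) := @polymap_fst _ _ _.
have [|[[[x z] y] z'] [Aq [Owq [/= Omq O'q]]]] := irreducibleW iP ow
   (open_preimage pfst (openI om oO')) nOw.
  have [||p2 [Ap2 [Omp2 O'p2]]] := irreducibleW
     (irreducible_prod (irreducible_prod iX iZ) (iXc i)) om oO'.
  - by exists (xm, zm, y0).
  - by exists p1; split=> //; split=> //; split.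
  - by exists (p2, u); split=> //; split.
(* The point z' is now fixed and (x, z, y) varies in the slice of [Ow] at z'. For each such triple,
   z' witnesses that the opposite slice, the open set of admissible z', is nonempty. *)
exists ((fun p : point => (p, z')) @^-1` Ow `&` Om `&`
   ((fun p : point => p.1.2) @^-1` Oz `&` (fun p : point => p.1.1) @^-1` Ox)).
have [[[cx cz] Xy] cz'] := Aq; rewrite /= in cx cz Xy cz'.
have Xxz := Xcat _ _ cx cz.
split.
- apply: openI; last by apply: openI;
    [exact: open_preimage oz|exact: open_preimage ox].
  by apply: openI => //; exact: open_preimage (polymap_pairl z') ow.
- exists (x, z, y); split=> //; split.
    split=> //=; first by apply/of_typeP; apply: typed_comps tx0.
    move=> l; apply: only_in_Xc; apply/compP.
    have : comp (z l) \in nseq s (Some j) by rewrite -cz map_f // codom_f.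
    by case/nseqP.
  split; first by [].
  split=> /=; [apply/hOz|apply/hOx] => // w hw; apply: Xxz.
    by rewrite mem_cat hw orbT.
  by rewrite mem_cat hw.
move=> [[x' z''] y'] [/= /of_typeP tx' Xz'' Xy'] [[Owp Omp] [/= Ozp Oxp]].
have cx' := (hOx _ (typed_inX tx')).1 Oxp.
have cz'' := (hOz _ (XzX _ Xz'')).1 Ozp.
apply: (apex_add_unit_eq (b := b s) (N := N)
  (O := (fun v => ((x', z'', y'), v)) @^-1` Ow)) => //.
- move=> zs us czs tus.
  have szs : size zs = s by rewrite -(size_map comp) czs size_nseq.
  have := maxN (x', ffun_of_seq s zs, us); rewrite /= codom_ffun_of_seq //.
  by apply.
- exists um => //; have := hOm (x', z'', y') (Xcat _ _ cx' cz'') Omp.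
  by rewrite -!span_cat -!catA.
- exact: open_preimage (polymap_pairr _) ow.
- by exists z'.
- move=> v cv Ov; have [|h1 h2] := hOw ((x', z'', y'), v) _ Ov; first by split.
  by split=> t ts; [apply: h1|apply: h2]; rewrite mem_iota add0n.
Qed.

End Apex.

Theorem lemma3p1 (R : realType) (G : groupType) (W V : vectType R[i])
    (rhoW : G -> 'End(W)) (rhoV : G -> 'End(V))
    (hW : is_gmodule rhoW) (hV : is_gmodule rhoV)
    (X : set W) (hX : quasi_affine_cone X)
    (hGX : forall g x, X x -> X (rhoW g x))
    (k : nat) (Xc : 'I_k -> set W) (hXc : irreducible_components X Xc)
    (E : W -> {vspace V}) (hE : embedded_vector_bundle E X)
    (hGE : equivariant E rhoW rhoV X)
    (alpha beta : 'I_k -> nat) (i j : 'I_k) (s : nat) :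
  let b t := bnum Xc E alpha (add_unit beta t j) i in
  b s <> 0%N -> b s = b s.+1 ->
  generically
    [set p : {ffun 'I_(size_type beta) -> W} * {ffun 'I_s -> W} * W |
      [/\ of_type Xc p.1.1, forall l, Xc j (p.1.2 l) & Xc i p.2]]
    (fun p => let x := codom p.1.1 in let z := codom p.1.2 in let y := p.2 in
      (apex Xc E alpha (x ++ z) :&: E y)%VS =
      (apex Xc E (add_unit alpha s j) x :&: E y)%VS).
Proof.
exact: (generic_apex_eq hXc (bundle_has_sections hE)).
Qed.
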